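(* Let $M$ be a commutative monoid. A self-map $r$ of $2^{M_0}$ is a weak ideal system on $M$ if and only if it is a nucleus on $2^{M_0}$ such that $\{0\}^r=\emptyset^r$ and $\{1\}^r=M_0$. Moreover, a weak ideal system $r$ on $M$ is an ideal system on $M$ if and only if every singleton in $2^{M_0}$ is transportable through $r$.
   Context: $M_0=M\amalg\{0\}$ is the monoid obtained from $M$ by adjoining a new element $0$ with $0x=0=x0$ for all $x\in M_0$. The power set $2^{M_0}$ is ordered by inclusion and has multiplication $XY=\{xy:x\in X,y\in Y\}$; $cX=\{cx:x\in X\}$ for $c\in M_0$. For a self-map $r$ write $x^r=r(x)$. A closure operation on a poset is an expansive ($x\le x^r$), order-preserving, idempotent self-map. A nucleus on an ordered magma is a closure operation $r$ with $x^ry^r\le(xy)^r$ for all $x,y$. An element $a$ of a magma is transportable through a self-map $r$ if $(ax)^r=ax^r$ and $(xa)^r=x^ra$ for all $x$. A weak ideal system on $M$ is a closure operation $r$ on $2^{M_0}$ such that $0\in\emptyset^r$, $cM_0\subset\{c\}^r$, and $cX^r\subset(cX)^r$ for all $c\in M_0$ and all $X\in2^{M_0}$. A weak ideal system $r$ on $M$ is an ideal system if $(cX)^r=cX^r$ for all $c\in M_0$ and all $X\in2^{M_0}$. *)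

(* Defs.v *)
From HB Require Import structures.
From mathcomp Require Import all_boot all_order.
From mathcomp Require Import boolp classical_sets.

Set Implicit Arguments.
Unset Strict Implicit.
Unset Printing Implicit Defensive.

Import Order.TTheory.
Export SetOrder.Exports.

Local Open Scope group_scope.
Local Open Scope order_scope.
Local Open Scope classical_set_scope.

HB.mixin Record isOrderedMagma (d : Order.disp_t) G
    of Magma G & Order.POrder d G := {
  le_mulg2 : forall x y z t : G, x <= y -> z <= t -> (x * z)%g <= (y * t)%g
}.

#[short(type="orderedMagmaType")]
HB.structure Definition OrderedMagma (d : Order.disp_t) :=
  {G of Magma G & Order.POrder d G & isOrderedMagma d G}.

Definition closure_operation d (T : porderType d) (r : T -> T) : Prop :=
  [/\ forall x, x <= r x,
      {homo r : x y / x <= y}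
    & forall x, r (r x) = r x].

Definition nucleus d (G : orderedMagmaType d) (r : G -> G) : Prop :=
  closure_operation r /\ forall x y : G, (r x * r y)%g <= r (x * y)%g.

Definition transportable (G : magmaType) (r : G -> G) (a : G) : Prop :=
  forall x : G, r (a * x)%g = (a * r x)%g /\ r (x * a)%g = (r x * a)%g.

(* [None] is the adjoined zero; [M] itself may already have an absorbing
   element, which is then distinct from [None]. *)
Definition adjoin0 (M : Type) : Type := option M.

HB.instance Definition _ (M : choiceType) := Choice.copy (adjoin0 M) (option M).

Definition zero0 {M : Type} : adjoin0 M := None.

Section Adjoin0.
Variable M : monoidType.

Definition mul0 (x y : adjoin0 M) : adjoin0 M :=
  if x is Some a then if y is Some b then Some (a * b)%g else None else None.

Definition one0 : adjoin0 M := Some 1%g.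

Fact mul0A : associative mul0.
Proof. by move=> [a|] [b|] [c|] //=; rewrite mulgA. Qed.

Fact mul01 : left_id one0 mul0.
Proof. by move=> [a|] //=; rewrite mul1g. Qed.

Fact mul10 : right_id one0 mul0.
Proof. by move=> [a|] //=; rewrite mulg1. Qed.

HB.instance Definition _ := isMonoid.Build (adjoin0 M) mul0A mul01 mul10.

End Adjoin0.

Section PowerSet.
Variable G : magmaType.

Definition set_mul (X Y : set G) : set G := [set (x * y)%g | x in X & y in Y].

HB.instance Definition _ := hasMul.Build (set G) set_mul.

Fact le_set_mul (X Y Z T : set G) :
  X <= Y -> Z <= T -> (X * Z)%g <= (Y * T)%g.
Proof. by rewrite !subsetEset; exact: image2_subset. Qed.

HB.instance Definition _ := isOrderedMagma.Build _ (set G) le_set_mul.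

End PowerSet.

Definition translate (G : magmaType) (c : G) (X : set G) : set G :=
  [set (c * x)%g | x in X].

Definition weak_ideal_system (M : monoidType)
    (r : set (adjoin0 M) -> set (adjoin0 M)) : Prop :=
  [/\ closure_operation r,
      r set0 zero0,
      forall c : adjoin0 M, translate c [set: adjoin0 M] `<=` r [set c]
    & forall (c : adjoin0 M) (X : set (adjoin0 M)),
        translate c (r X) `<=` r (translate c X)].

Definition ideal_system (M : monoidType)
    (r : set (adjoin0 M) -> set (adjoin0 M)) : Prop :=
  weak_ideal_system r /\
  forall (c : adjoin0 M) (X : set (adjoin0 M)),
    r (translate c X) = translate c (r X).

(* Main.v *)
Require Import Defs.
From mathcomp Require Import all_boot all_order.
From mathcomp Require Import boolp classical_sets.

Import Order.TTheory.

Local Open Scope classical_set_scope.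

(** By [set_mul1l], translating by [c] is multiplying by the singleton of [c]. The translation law
    of a weak ideal system is thus the nucleus inequality with a singleton as left factor;
    conversely, a product of sets is a union of translates, so the law, used once in each variable,
    gives the full inequality ([weak_ideal_system_nucleus]). The other axioms only fix the closures
    of the empty set and of the unit. The same dictionary turns the equality defining ideal systems
    into transportability of singletons. *)

Lemma set_mul1l {G : magmaType} (c : G) (X : set G) :
  ([set c] * X)%g = translate c X.
Proof.
apply/seteqP; split=> [_ [_ -> [x Xx <-]] | _ [x Xx <-]]; first by exists x.
by exists c => //; exists x.
Qed.

Lemma set_mulC {G : magmaType} (mulC : forall x y : G, (x * y)%g = (y * x)%g)
    (X Y : set G) : (X * Y)%g = (Y * X)%g.
Proof.
by apply/seteqP; split=> _ [x Xx [y Yy <-]]; exists y => //; exists x.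
Qed.

Lemma adjoin0_mulC {M : monoidType}
    (mulC : forall x y : M, (x * y)%g = (y * x)%g) (x y : adjoin0 M) :
  (x * y)%g = (y * x)%g.
Proof. by case: x y => [a|] [b|] //; congr Some; exact: mulC. Qed.

(** Idempotence absorbs the second [r]. This serves when an element is known only to lie in a
    closure, as with [x] in [r X] or [zero0] in [r set0]. *)
Lemma le_closure_operation {d} {T : porderType d} {r : T -> T} {x y : T} :
  closure_operation r -> (x <= r y)%O -> (r x <= r y)%O.
Proof. by case=> _ r_homo r_idem /r_homo; rewrite r_idem. Qed.

Lemma weak_ideal_system_nucleus {M : monoidType}
    (mulC : forall x y : M, (x * y)%g = (y * x)%g)
    {r : set (adjoin0 M) -> set (adjoin0 M)} :
  weak_ideal_system r -> nucleus r.
Proof.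
move=> [r_cl _ _ r_tr]; split=> // X Y.
(* Commutativity lets [r_tr] be used in each variable in turn:
   [r X * y <= r (X * Y)] for [y] in [Y], then [x * r Y <= r (X * Y)]
   for [x] in [r X]. *)
have [_ r_homo _] := r_cl.
rewrite subsetEset => _ [x rXx [y rYy <-]].
have xY : (translate x Y <= r (X * Y)%g)%O.
  rewrite subsetEset => _ [z Yz <-]; rewrite adjoin0_mulC //.
  have : (r (translate z X) <= r (X * Y)%g)%O.
    apply: r_homo; rewrite -set_mul1l (set_mulC (adjoin0_mulC mulC)).
    by apply: le_mulg2; rewrite subsetEset // => _ ->.
  by rewrite subsetEset; apply; apply: r_tr; exists x.
have := le_closure_operation r_cl xY.
by rewrite subsetEset; apply; apply: r_tr; exists y.
Qed.

Lemma weak_ideal_systemP {M : monoidType}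
    (mulC : forall x y : M, (x * y)%g = (y * x)%g)
    {r : set (adjoin0 M) -> set (adjoin0 M)} :
  weak_ideal_system r <->
    [/\ nucleus r,
        r [set zero0] = r set0
      & r [set 1%g] = [set: adjoin0 M]].
Proof.
split=> [r_weak | [[r_cl r_mul] r0 r1]].
  have [r_cl r0 r_unit _] := r_weak; have [_ r_homo _] := r_cl.
  split; first exact: weak_ideal_system_nucleus.
  - apply: le_anti; apply/andP; split; last by apply: r_homo; rewrite subsetEset.
    by apply: le_closure_operation => //; rewrite subsetEset => _ ->.
  - apply/seteqP; split=> // x _; apply: r_unit.
    by exists x => //; rewrite mul1g.
have [r_ext _ _] := r_cl.
have r_tr c X : translate c (r X) `<=` r (translate c X).
  (* Expansivity enlarges the factor [[set c]] to [r [set c]], and the nucleus inequality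
     applies. *)
  rewrite -!set_mul1l -subsetEset; apply: le_trans (r_mul _ _).
  exact: le_mulg2.
split=> //.
  by rewrite -r0; have := r_ext [set zero0]; rewrite subsetEset; apply.
(* The whole monoid is the closure of the unit, whose translate by [c] is [[set c]]. *)
move=> c; rewrite -r1; apply: subset_trans (r_tr c _) _.
by rewrite /translate image_set1 mulg1.
Qed.

Theorem proposition12p1 (M : monoidType)
    (mulC : forall x y : M, (x * y)%g = (y * x)%g)
    (r : set (adjoin0 M) -> set (adjoin0 M)) :
  (weak_ideal_system r <->
     [/\ nucleus r,
         r [set zero0] = r set0
       & r [set 1%g] = [set: adjoin0 M]]) /\
  (weak_ideal_system r ->
     (ideal_system r <->
        forall c : adjoin0 M, transportable r [set c])).
Proof.
split=> [|r_weak]; first exact: weak_ideal_systemP.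
split=> [[_ r_tr] c X | r_tr].
  (* Commutativity reduces right transport to left transport. *)
  by rewrite !(set_mulC (adjoin0_mulC mulC) _ [set c]) !set_mul1l r_tr.
split=> // c X; have [+ _] := r_tr c X.
by rewrite !set_mul1l.
Qed.
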